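(* Let $S\in\{\tfrac12,1,\tfrac32,\dots\}$, let $f,g:\mathbb N_0^2\to\mathbb C$, and consider $$\hat S^+=\hat a_1^\dagger\hat a_2\,f(\hat n_1,\hat n_2),\qquad \hat S^-=\hat a_2^\dagger\hat a_1\,g(\hat n_1,\hat n_2),\qquad \hat S^z=\frac{\hat n_1-\hat n_2}{2}.$$ For every choice of $f,g$ one has $[\hat S^z,\hat S^\pm]=\pm\hat S^\pm$ and $[\hat n_1+\hat n_2,\hat S^\pm]=0$. Let $\mathcal H_{2S}=\mathrm{span}\{|2S-n,n\rangle:0\le n\le 2S\}$, which is the subspace $\hat n_1+\hat n_2=2S$. Then the relation $[\hat S^+,\hat S^-]=2\hat S^z$ holds on $\mathcal H_{2S}$ if and only if $$f(2S-n-1,\,n+1)\;g(2S-n,\,n)=1\qquad\text{for all } n=0,1,\dots,2S-1 .$$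
   Context: Two independent bosonic modes: the Fock space has basis $\{|n_1,n_2\rangle:(n_1,n_2)\in\mathbb N_0^2\}$ (finite linear combinations), with $\hat a_1|n_1,n_2\rangle=\sqrt{n_1}|n_1-1,n_2\rangle$, $\hat a_1^\dagger|n_1,n_2\rangle=\sqrt{n_1+1}|n_1+1,n_2\rangle$, and similarly for $\hat a_2,\hat a_2^\dagger$ acting on $n_2$; $\hat n_i=\hat a_i^\dagger\hat a_i$. For $F:\mathbb N_0^2\to\mathbb C$, $F(\hat n_1,\hat n_2)|n_1,n_2\rangle=F(n_1,n_2)|n_1,n_2\rangle$. *)

(* Defs.v *)
From HB Require Import structures.
From mathcomp Require Import all_boot all_order all_algebra.
From mathcomp Require Import finmap.
From mathcomp Require Import monalg.

Set Implicit Arguments.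
Unset Strict Implicit.
Unset Printing Implicit Defensive.

Import GRing.Theory Num.Theory.

Local Open Scope ring_scope.

Section Fock.
Variable C : numClosedFieldType.

(* Finitely supported functions nat * nat -> C; only the C-module structure of
   malg is used. *)
Definition fock := {malg C[(nat * nat)%type]}.

Definition ket (n1 n2 : nat) : fock := << (n1, n2) >>.

Definition lin_ext (phi : nat -> nat -> fock) (psi : fock) : fock :=
  \sum_(k <- msupp psi) psi@_k *: phi k.1 k.2.

Lemma lin_extEw phi (D : {fset (nat * nat)%type}) (psi : fock) :
  (msupp psi `<=` D)%fset ->
  lin_ext phi psi = \sum_(k <- D) psi@_k *: phi k.1 k.2.
Proof.
move=> sD; rewrite /lin_ext (big_fset_incl _ sD) // => k _.
by move=> /mcoeff_outdom ->; rewrite scale0r.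
Qed.

Lemma lin_ext_is_linear phi : linear (lin_ext phi).
Proof.
move=> a u v; pose D := (msupp (a *: u + v) `|` (msupp u `|` msupp v))%fset.
have sa : (msupp (a *: u + v) `<=` D)%fset by apply: fsubsetUl.
have su : (msupp u `<=` D)%fset
  by apply: fsubset_trans (fsubsetUl _ _) (fsubsetUr _ _).
have sv : (msupp v `<=` D)%fset
  by apply: fsubset_trans (fsubsetUr _ _) (fsubsetUr _ _).
rewrite !(lin_extEw _ sa) (lin_extEw _ su) (lin_extEw _ sv).
rewrite scaler_sumr -big_split /=; apply: eq_bigr => k _.
by rewrite mcoeffD mcoeffZ scalerDl scalerA.
Qed.

HB.instance Definition _ phi :=
  GRing.isLinear.Build C fock fock _ (lin_ext phi) (lin_ext_is_linear phi).

Lemma lin_ext_ket phi n1 n2 : lin_ext phi (ket n1 n2) = phi n1 n2.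
Proof.
rewrite (@lin_extEw _ [fset (n1, n2)]%fset) ?big_seq_fset1; last first.
  exact: msuppU_le.
by rewrite mcoeffUU scale1r.
Qed.

(* sqrtC of a nonnegative number is its nonnegative square root (sqrtC_ge0). *)
Definition sqrtn (n : nat) : C := sqrtC n%:R.

(* At n1 = 0 (resp. n2 = 0) the truncated predecessor is harmless, since the
   coefficient sqrtn 0 vanishes. *)
Definition a1 := lin_ext (fun n1 n2 => sqrtn n1 *: ket n1.-1 n2).
Definition a1dag := lin_ext (fun n1 n2 => sqrtn n1.+1 *: ket n1.+1 n2).
Definition a2 := lin_ext (fun n1 n2 => sqrtn n2 *: ket n1 n2.-1).
Definition a2dag := lin_ext (fun n1 n2 => sqrtn n2.+1 *: ket n1 n2.+1).
HB.instance Definition _ := GRing.Linear.copy a1 (lin_ext _).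
HB.instance Definition _ := GRing.Linear.copy a1dag (lin_ext _).
HB.instance Definition _ := GRing.Linear.copy a2 (lin_ext _).
HB.instance Definition _ := GRing.Linear.copy a2dag (lin_ext _).

Definition num1 : fock -> fock := a1dag \o a1.
Definition num2 : fock -> fock := a2dag \o a2.

Definition fun_of_num (F : nat -> nat -> C) :=
  lin_ext (fun n1 n2 => F n1 n2 *: ket n1 n2).
HB.instance Definition _ F := GRing.Linear.copy (fun_of_num F) (lin_ext _).

Definition Splus (f : nat -> nat -> C) : fock -> fock :=
  a1dag \o a2 \o fun_of_num f.
Definition Sminus (g : nat -> nat -> C) : fock -> fock :=
  a2dag \o a1 \o fun_of_num g.
Definition Sz : fock -> fock := fun psi => 2^-1 *: (num1 psi - num2 psi).

Definition commutator (A B : fock -> fock) : fock -> fock :=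
  fun psi => A (B psi) - B (A psi).

(* span {|d - n, n> : 0 <= n <= d}, as a predicate on states. *)
Definition sector (d : nat) (psi : fock) : Prop :=
  exists c : 'I_d.+1 -> C, psi = \sum_(n < d.+1) c n *: ket (d - n) n.

End Fock.

Arguments a1 {C} psi.
Arguments a1dag {C} psi.
Arguments a2 {C} psi.
Arguments a2dag {C} psi.
Arguments num1 {C} psi.
Arguments num2 {C} psi.
Arguments Sz {C} psi.

(* Main.v *)
Require Import Defs.
From HB Require Import structures.
From mathcomp Require Import all_boot all_order all_algebra.
From mathcomp Require Import reals complex monalg.
From mathcomp Require Import ring.

Import GRing.Theory Num.Theory.

Local Open Scope ring_scope.
Local Open Scope complex_scope.

(** The operators num1, num2 and Sz are diagonal on kets, while Splus and
   Sminus shift (n1, n2) to (n1 + 1, n2 - 1) and (n1 - 1, n2 + 1), so every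
   identity is an identity between coefficients of kets.  With
   p n = f (d - n - 1) (n + 1) * g (d - n) n, the relation [S+, S-] = 2 Sz at the ket |d - n, n> reads
     (d - n) (n + 1) p n - n (d - n + 1) p (n - 1) = d - 2 n,
   which the constant 1 solves; as the first coefficient does not vanish for
   n < d, the recurrence determines p from its n = 0 instance d * p 0 = d. *)

Section Operators.
Variable C : numClosedFieldType.
Implicit Types (f g F : nat -> nat -> C) (psi : fock C).

(** These operators are defined as bare functions; registering their linearity allows every identity
    between them to be checked on kets alone. *)
HB.instance Definition _ := GRing.Linear.copy (@num1 C) (a1dag \o a1).
HB.instance Definition _ := GRing.Linear.copy (@num2 C) (a2dag \o a2).
HB.instance Definition _ :=
  GRing.Linear.copy (@Sz C) (2^-1 \*: (num1 \- num2)).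
HB.instance Definition _ f :=
  GRing.Linear.copy (Splus f) (a1dag \o a2 \o fun_of_num f).
HB.instance Definition _ g :=
  GRing.Linear.copy (Sminus g) (a2dag \o a1 \o fun_of_num g).

Lemma commutator_is_linear (A B : {linear fock C -> fock C}) :
  linear (commutator A B).
Proof.
by move=> a u v; rewrite /commutator !linearP scalerDr addrACA.
Qed.

HB.instance Definition _ (A B : {linear fock C -> fock C}) :=
  GRing.isLinear.Build C (fock C) (fock C) _ (commutator A B)
    (commutator_is_linear A B).

Lemma eq_commutatorl (A A' B : fock C -> fock C) :
  A =1 A' -> commutator A B =1 commutator A' B.
Proof. by move=> eqA psi; rewrite /commutator !eqA. Qed.

Lemma mcoeff_ket n1 n2 (k : nat * nat) :
  (ket C n1 n2)@_k = ((n1, n2) == k)%:R.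
Proof. by rewrite mcoeffU. Qed.

Lemma malgU_ket c (k : nat * nat) : << c *g k >> = c *: ket C k.1 k.2.
Proof.
by apply/malgP => l; rewrite mcoeffZ mcoeff_ket mcoeffU mulr_natr; case: k.
Qed.

Lemma eq_linear_ket (A B : {linear fock C -> fock C}) :
  (forall n1 n2, A (ket C n1 n2) = B (ket C n1 n2)) -> A =1 B.
Proof.
move=> eqAB psi; rewrite (monalgE psi) !linear_sum; apply: eq_bigr => k _.
by rewrite malgU_ket !linearZ eqAB.
Qed.

(** * Diagonal operators *)

Lemma fun_of_num_ket F n1 n2 :
  fun_of_num F (ket C n1 n2) = F n1 n2 *: ket C n1 n2.
Proof. exact: lin_ext_ket. Qed.

(** Needed on arbitrary states, not only kets: it turns an eigenvalue equation into one scalar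
    equation per coefficient. *)
Lemma mcoeff_fun_of_num F psi (k : nat * nat) :
  (fun_of_num F psi)@_k = F k.1 k.2 * psi@_k.
Proof.
rewrite (monalgE psi) linear_sum !raddf_sum mulr_sumr; apply: eq_bigr => l _.
rewrite malgU_ket linearZ /= fun_of_num_ket !mcoeffZ mcoeff_ket.
rewrite -surjective_pairing mulrCA.
by case: eqP => [->|_] //; rewrite !mulr0.
Qed.

Lemma sqrtn_sqr n : sqrtn C n * sqrtn C n = n%:R.
Proof. by rewrite -expr2 sqrtCK. Qed.

Lemma sqrtn0 : sqrtn C 0 = 0.
Proof. exact: sqrtC0. Qed.

Lemma num1E : @num1 C =1 fun_of_num (fun n1 _ => n1%:R).
Proof.
apply: (eq_linear_ket num1 (fun_of_num _)) => n1 n2.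
rewrite /= fun_of_num_ket /num1 /= [a1 _]lin_ext_ket linearZ /=.
rewrite [a1dag _]lin_ext_ket scalerA.
(* At [n1 = 0] the truncated predecessor leads to the wrong ket, [ket 1 n2], but its coefficient
   contains [sqrtn 0]. *)
case: n1 => [|n1]; last by rewrite sqrtn_sqr.
by rewrite sqrtn0 mul0r !scale0r.
Qed.

Lemma num2E : @num2 C =1 fun_of_num (fun _ n2 => n2%:R).
Proof.
apply: (eq_linear_ket num2 (fun_of_num _)) => n1 n2.
rewrite /= fun_of_num_ket /num2 /= [a2 _]lin_ext_ket linearZ /=.
rewrite [a2dag _]lin_ext_ket scalerA.
case: n2 => [|n2]; last by rewrite sqrtn_sqr.
by rewrite sqrtn0 mul0r !scale0r.
Qed.

Lemma num12E : @num1 C \+ @num2 C =1 fun_of_num (fun n1 n2 => (n1 + n2)%:R).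
Proof.
apply: eq_linear_ket => n1 n2 /=.
by rewrite num1E num2E !fun_of_num_ket -scalerDl natrD.
Qed.

Lemma SzE : @Sz C =1 fun_of_num (fun n1 n2 => 2^-1 * (n1%:R - n2%:R)).
Proof.
apply: (eq_linear_ket Sz (fun_of_num _)) => n1 n2 /=.
by rewrite /Sz num1E num2E !fun_of_num_ket -scalerBl scalerA.
Qed.

(** * Ladder operators and their commutators with diagonal operators *)

Lemma Splus_ket f n1 n2 :
  Splus f (ket C n1 n2) =
    (f n1 n2 * (sqrtn C n2 * sqrtn C n1.+1)) *: ket C n1.+1 n2.-1.
Proof.
rewrite /Splus /= fun_of_num_ket !linearZ /= [a2 _]lin_ext_ket linearZ /=.
by rewrite [a1dag _]lin_ext_ket !scalerA mulrA.
Qed.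

Lemma Sminus_ket g n1 n2 :
  Sminus g (ket C n1 n2) =
    (g n1 n2 * (sqrtn C n1 * sqrtn C n2.+1)) *: ket C n1.-1 n2.+1.
Proof.
rewrite /Sminus /= fun_of_num_ket !linearZ /= [a1 _]lin_ext_ket linearZ /=.
by rewrite [a2dag _]lin_ext_ket !scalerA mulrA.
Qed.

(** [Splus] moves one quantum from mode 2 to mode 1, so the commutator multiplies it by the
    increment of [F] along this move. The increment is 1 for [Sz] and 0 for the total number. *)
Lemma commutator_fun_of_num_Splus F f c :
    (forall n1 n2, F n1.+1 n2 - F n1 n2.+1 = c) ->
  commutator (fun_of_num F) (Splus f) =1 (fun psi => c *: Splus f psi).
Proof.
move=> Fc; apply: (eq_linear_ket (commutator _ _) (c \*: Splus f)) => n1 n2.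
rewrite /= /commutator fun_of_num_ket linearZ /= Splus_ket.
rewrite linearZ /= fun_of_num_ket !scalerA -scalerBl.
(* [Fc] says nothing at [n2 = 0], where [Splus] annihilates the ket. *)
case: n2 => [|n2] /=; first by rewrite sqrtn0 !(mul0r, mulr0) subr0.
by congr (_ *: _); rewrite -(Fc n1 n2); ring.
Qed.

Lemma commutator_fun_of_num_Sminus F g c :
    (forall n1 n2, F n1 n2.+1 - F n1.+1 n2 = c) ->
  commutator (fun_of_num F) (Sminus g) =1 (fun psi => c *: Sminus g psi).
Proof.
move=> Fc; apply: (eq_linear_ket (commutator _ _) (c \*: Sminus g)) => n1 n2.
rewrite /= /commutator fun_of_num_ket linearZ /= Sminus_ket.
rewrite linearZ /= fun_of_num_ket !scalerA -scalerBl.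
case: n1 => [|n1] /=; first by rewrite sqrtn0 !(mul0r, mulr0) subr0.
by congr (_ *: _); rewrite -(Fc n1 n2); ring.
Qed.

Lemma commutator_Sz_Splus f : commutator Sz (Splus f) =1 Splus f.
Proof.
move=> psi; rewrite (eq_commutatorl _ _ _ SzE).
rewrite (commutator_fun_of_num_Splus _ _ 1) ?scale1r // => n1 n2.
by rewrite -!natr1; field.
Qed.

Lemma commutator_Sz_Sminus g :
  commutator Sz (Sminus g) =1 (fun psi => - Sminus g psi).
Proof.
move=> psi; rewrite (eq_commutatorl _ _ _ SzE).
rewrite (commutator_fun_of_num_Sminus _ _ (- 1)) ?scaleN1r // => n1 n2.
by rewrite -!natr1; field.
Qed.

Lemma commutator_num12_Splus f :
  commutator (num1 \+ num2) (Splus f) =1 (fun=> 0).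
Proof.
move=> psi; rewrite (eq_commutatorl _ _ _ num12E).
rewrite (commutator_fun_of_num_Splus _ _ 0) ?scale0r // => n1 n2.
by rewrite addSnnS subrr.
Qed.

Lemma commutator_num12_Sminus g :
  commutator (num1 \+ num2) (Sminus g) =1 (fun=> 0).
Proof.
move=> psi; rewrite (eq_commutatorl _ _ _ num12E).
rewrite (commutator_fun_of_num_Sminus _ _ 0) ?scale0r // => n1 n2.
by rewrite addSnnS subrr.
Qed.

(** * The sector as a span and as an eigenspace *)

Lemma sector_ket d n : (n <= d)%N -> sector d (ket C (d - n) n).
Proof.
move=> le_nd; exists (fun i : 'I_d.+1 => (i == n :> nat)%:R).
rewrite (bigD1 (inord n)) //= inordK // eqxx scale1r big1 ?addr0 // => i.
by rewrite -val_eqE /= inordK // => /negPf->; rewrite scale0r.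
Qed.

Lemma eq_linear_sector d (A B : {linear fock C -> fock C}) :
    (forall n, (n <= d)%N -> A (ket C (d - n) n) = B (ket C (d - n) n)) ->
  forall psi, sector d psi -> A psi = B psi.
Proof.
move=> eqAB _ [c ->]; rewrite !linear_sum; apply: eq_bigr => n _.
by rewrite !linearZ eqAB // -ltnS.
Qed.

Lemma sectorP d psi :
  sector d psi <-> num1 psi + num2 psi = d%:R *: psi.
Proof.
have -> : num1 psi + num2 psi = (num1 \+ num2) psi by [].
rewrite num12E; split=> [[c ->]|eig].
  rewrite linear_sum scaler_sumr; apply: eq_bigr => n _.
  rewrite linearZ /= fun_of_num_ket subnK ?scalerA 1?mulrC //.
  by rewrite -ltnS.
(* The coefficient at [k] satisfies [(k.1 + k.2) * psi@_k = d * psi@_k], and distinct naturals stay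
   distinct in [C]. *)
have psi0 (k : nat * nat) : (k.1 + k.2)%N != d -> psi@_k = 0.
  move=> kd; apply/eqP; move/malgP/(_ k)/eqP: eig.
  rewrite mcoeff_fun_of_num mcoeffZ -subr_eq0 -mulrBl mulf_eq0 subr_eq0.
  by rewrite eqr_nat (negPf kd).
exists (fun n => psi@_((d - n)%N, n : nat)); apply/malgP => -[k1 k2].
rewrite raddf_sum /=.
under eq_bigr do rewrite mcoeffZ mcoeff_ket.
(* Off the level [k1 + k2 = d] both sides vanish; on it only the summand of index [k2]
   contributes. *)
have [kd|kd] := eqVneq (k1 + k2)%N d; last first.
  rewrite psi0 // big1 // => i _; case: eqP => [[ek1 ek2]|_]; last first.
    by rewrite mulr0.
  by move: kd; rewrite -ek1 -ek2 subnK ?eqxx // -ltnS.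
have dk2 : (d - k2 = k1)%N by rewrite -kd addnK.
have lt_k2 : (k2 < d.+1)%N by rewrite -kd ltnS leq_addl.
rewrite (bigD1 (Ordinal lt_k2)) //= dk2 eqxx mulr1 big1 ?addr0 // => i.
rewrite -val_eqE /= => ik2.
by rewrite xpair_eqE (negPf ik2) andbF mulr0.
Qed.

(** * The commutator of [Splus] and [Sminus] *)

Lemma Splus_Sminus_ket f g n1 n2 :
  Splus f (Sminus g (ket C n1 n2)) =
    (n1%:R * n2.+1%:R * (f n1.-1 n2.+1 * g n1 n2)) *: ket C n1 n2.
Proof.
rewrite Sminus_ket linearZ /= Splus_ket scalerA.
case: n1 => [|n1] /=; first by rewrite sqrtn0 !(mul0r, mulr0) !scale0r.
(* The way back meets the same square roots as the way out, so they pair up into integers. *)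
by congr (_ *: _); rewrite -!sqrtn_sqr; ring.
Qed.

Lemma Sminus_Splus_ket f g n1 n2 :
  Sminus g (Splus f (ket C n1 n2)) =
    (n2%:R * n1.+1%:R * (f n1 n2 * g n1.+1 n2.-1)) *: ket C n1 n2.
Proof.
rewrite Splus_ket linearZ /= Sminus_ket scalerA.
case: n2 => [|n2] /=; first by rewrite sqrtn0 !(mul0r, mulr0) !scale0r.
by congr (_ *: _); rewrite -!sqrtn_sqr; ring.
Qed.

Lemma commutator_Spm_ket f g n1 n2 :
  commutator (Splus f) (Sminus g) (ket C n1 n2) =
    (n1%:R * n2.+1%:R * (f n1.-1 n2.+1 * g n1 n2)
     - n2%:R * n1.+1%:R * (f n1 n2 * g n1.+1 n2.-1)) *: ket C n1 n2.
Proof. by rewrite /commutator Splus_Sminus_ket Sminus_Splus_ket -scalerBl. Qed.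

Lemma two_Sz_ket n1 n2 :
  2 *: Sz (ket C n1 n2) = (n1%:R - n2%:R) *: ket C n1 n2.
Proof.
by rewrite SzE fun_of_num_ket scalerA mulrA mulfV ?mul1r // pnatr_eq0.
Qed.

Lemma scaler_ket_inj n1 n2 : injective (fun c : C => c *: ket C n1 n2).
Proof.
move=> a b /malgP/(_ (n1, n2)).
by rewrite !mcoeffZ mcoeff_ket eqxx !mulr1.
Qed.

Lemma Spm_relationP d f g :
  (forall psi, sector d psi ->
     commutator (Splus f) (Sminus g) psi = 2 *: Sz psi)
  <-> (forall n, (n < d)%N -> f (d - n - 1)%N n.+1 * g (d - n)%N n = 1).
Proof.
split=> [rel | fg1].
  elim=> [|n IHn] lt_nd; have := rel _ (sector_ket _ _ (ltnW lt_nd));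
    rewrite commutator_Spm_ket two_Sz_ket => /scaler_ket_inj.
    rewrite subn0 subn1 !mul0r !subr0 mulr1 => rel0.
    have nz : d%:R != 0 :> C by rewrite pnatr_eq0 -lt0n.
    by apply: (mulfI nz); rewrite rel0 mulr1.
  have := IHn (ltnW lt_nd).
  (* This rewriting makes the induction hypothesis match the second product of the relation at the
     ket of index [n.+1]. *)
  have -> : (d - n = (d - n.+1).+1)%N by rewrite subnSK // ltnW.
  rewrite !subn1 /= => -> rel_n.
  have nz : (d - n.+1)%:R * n.+2%:R != 0 :> C.
    by rewrite -natrM pnatr_eq0 muln_eq0 orbF -lt0n subn_gt0.
  (* The goal is multiplied by the nonzero factor, and the second term of the relation, whose
     product is now 1, is subtracted from both sides. *)
  apply/(mulfI nz)/(addIr (- (n.+1%:R * (d - n.+1).+1%:R * 1))).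
  by rewrite rel_n -!natr1; ring.
apply: (eq_linear_sector d (commutator _ _) (2 \*: Sz)) => n le_nd /=.
rewrite two_Sz_ket commutator_Spm_ket; congr (_ *: _).
(* The prefactor covers the end [n = d], where the hypothesis is silent; in [fg1r] the prefactor [n]
   does the same at [n = 0], and otherwise the hypothesis is used at [n - 1]. *)
have fg1l : (d - n)%:R * (f (d - n).-1 n.+1 * g (d - n)%N n) = (d - n)%:R.
  have [lt_nd|le_dn] := ltnP n d; first by rewrite -subn1 fg1 ?mulr1.
  by have /eqP-> := le_dn; rewrite !mul0r.
have fg1r : n%:R * (f (d - n)%N n * g (d - n).+1 n.-1) = n%:R.
  case: n {fg1l} le_nd => [|n] lt_nd; first by rewrite !mul0r.
  by have := fg1 _ lt_nd; rewrite -subnDA addn1 subnSK // => ->; rewrite mulr1.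
by rewrite mulrAC fg1l mulrAC fg1r -!natr1; ring.
Qed.

End Operators.

Theorem mainTheorem3 (R : realType) (S : R) (d : nat) (d_gt0 : (0 < d)%N)
    (twoS : 2 * S = d%:R) (f g : nat -> nat -> R[i]) :
  (commutator Sz (Splus f) =1 Splus f
   /\ commutator Sz (Sminus g) =1 (fun psi => - Sminus g psi)
   /\ commutator (num1 \+ num2) (Splus f) =1 (fun=> 0)
   /\ commutator (num1 \+ num2) (Sminus g) =1 (fun=> 0))
  /\ (forall psi : fock R[i],
        sector d psi <-> num1 psi + num2 psi = (2 * S)%:C *: psi)
  /\ ((forall psi : fock R[i], sector d psi ->
         commutator (Splus f) (Sminus g) psi = 2 *: Sz psi)
      <->
      (forall n : nat, (n < d)%N ->
         f (d - n - 1)%N n.+1 * g (d - n)%N n = 1)).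
Proof.
split; last split; last exact: Spm_relationP.
  split; first exact: commutator_Sz_Splus.
  split; first exact: commutator_Sz_Sminus.
  by split; [exact: commutator_num12_Splus | exact: commutator_num12_Sminus].
(* The embedding of the reals into [R[i]] sends the natural number [2 * S = d] to [d%:R]. *)
by move=> psi; rewrite twoS rmorph_nat; exact: sectorP.
Qed.
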